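(* For every pair of positive integers $k,h$ there exists an integer $\phi(k,h)$, depending only on $k$ and $h$, such that every asymptotic basis $A$ for $\mathbb{N}_0$ of order $h$ has at most $\phi(k,h)$ essential subsets of size at most $k$.
   Context: All sets are subsets of $\mathbb{N}_0=\{0,1,2,\dots\}$. For $A\subseteq\mathbb{N}_0$ with $0\in A$ and an integer $h\ge 1$, $hA=\{a_1+\cdots+a_h : a_1,\dots,a_h\in A\}$. A set $B\subseteq\mathbb{N}_0$ is an asymptotic basis of order $h$ if all but finitely many non-negative integers can be written as a sum of at most $h$ elements of $B$ (for $0\in B$ this says $\mathbb{N}_0\setminus hB$ is finite); $B$ is an asymptotic basis (of some order) if it is one of order $h$ for some $h$. If $A$ is an asymptotic basis, an essentiality of $A$ is a subset $P\subseteq A$ such that $A\setminus P$ is not an asymptotic basis of any order, and $P$ is minimal with respect to inclusion among subsets of $A$ with this property. A finite essentiality is called an essential subset of $A$. *)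

(* Defs.v *)
From mathcomp Require Import all_boot.
From mathcomp Require Import boolp classical_sets cardinality.

Set Implicit Arguments.
Unset Strict Implicit.
Unset Printing Implicit Defensive.

Local Open Scope classical_set_scope.

(* Summands may repeat; the empty sum 0 is always included, which does not
   affect cofiniteness. *)
Definition sums_at_most (h : nat) (B : set nat) : set nat :=
  [set n | exists s : seq nat,
     [/\ (size s <= h)%N, (forall x, x \in s -> B x) & n = sumn s]].

Definition asymptotic_basis_of_order (h : nat) (B : set nat) : Prop :=
  finite_set (~` sums_at_most h B).

Definition asymptotic_basis (B : set nat) : Prop :=
  exists2 h, (0 < h)%N & asymptotic_basis_of_order h B.

Definition essentiality (A P : set nat) : Prop :=
  [/\ asymptotic_basis A,
      P `<=` A,
      ~ asymptotic_basis (A `\` P) &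
      forall Q : set nat, Q `<=` A -> ~ asymptotic_basis (A `\` Q) ->
        Q `<=` P -> Q = P].

Definition essential_subset (A P : set nat) : Prop :=
  essentiality A P /\ finite_set P.

(* Main.v *)
Require Import Defs.
From mathcomp Require Import all_boot.
From mathcomp Require Import unstable boolp classical_sets cardinality.
From mathcomp Require Import finmap zify.

Set Implicit Arguments.
Unset Strict Implicit.
Unset Printing Implicit Defensive.

Local Open Scope classical_set_scope.
Local Open Scope card_scope.

(** If [P] is finite, [A \ P] is a basis as soon as no prime divides all of its
    elements: the differences of its sums are closed under gcd, so [s] and
    [s + 1] are both sums for some [s], and in a representation of [n - V s],
    with [V] a bound for the contribution [v <= V] of [P], one replaces the sum
    [v + V s] by [v (s + 1) + (V - v) s].  By minimality an essential subset is
    thus the set of elements of [A] that a suitable prime does not divide.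

    If [N] primes [p] each divide all but [k] elements of [A], their product
    [q >= 2 ^ N] divides all but [k N] elements of [A], while every residue
    modulo [q] is a sum of at most [h] elements of [A].  Therefore
    [2 ^ N <= (k N + 1) ^ h], which bounds [N]. *)

Lemma leqW_exp2r (e m n : nat) : m <= n -> m ^ e <= n ^ e.
Proof. by case: e => // e le_mn; rewrite leq_exp2r. Qed.

(* With [d := 2 h + 1] and [m := n %/ d], large [n] satisfy
   [k n + 1 <= (m + 1) ^ 2], and [(m + 1) ^ (2 h) <= b ^ (2 h m) < b ^ n]. *)
Lemma linear_exp_ltn_exp_eventually (b k h : nat) : 1 < b ->
  exists N, forall n, N <= n -> (k * n).+1 ^ h < b ^ n.
Proof.
move=> b_gt1; pose d := (2 * h).+1; exists (d * (d * k).+1) => n le_n.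
pose m := n %/ d.
have n_lt : n < d * m.+1 by rewrite mulnC ltn_ceil.
have m_gt : d * k < m by rewrite leq_divRL // mulnC.
have kn_le : (k * n).+1 <= m.+1 ^ 2.
  have : k * n <= d * k * m.+1 by rewrite mulnAC mulnC leq_mul // ltnW.
  by rewrite -mulnn; nia.
have m_lt : 2 * h * m < n.
  by have := leq_divM n d; rewrite -/m /d; nia.
apply: leq_ltn_trans (_ : b ^ (2 * h * m) < _); last by rewrite ltn_exp2l.
apply: leq_trans (leqW_exp2r h kn_le) _.
by rewrite -expnM [2 * h * m]mulnC (expnM b) leqW_exp2r // ltn_expl.
Qed.

Lemma uniq_prime_pairwise_coprime (r : seq nat) :
  uniq r -> all prime r -> pairwise coprime r.
Proof.
rewrite uniq_pairwise => r_uniq r_pr; apply: sub_in_pairwise r_pr r_uniq.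
by move=> p q p_pr q_pr /= neq_pq; rewrite prime_coprime // dvdn_prime2.
Qed.

Lemma leq_exp_prod (b : nat) (r : seq nat) :
  all (leq b) r -> b ^ size r <= \prod_(d <- r) d.
Proof.
elim: r => [|d r IHr] /=; first by rewrite big_nil.
by move=> /andP[le_bd /IHr le_r]; rewrite big_cons expnS leq_mul.
Qed.

Lemma card_le_II_seqP (T : choiceType) (X : set T) (n : nat) :
  X #<= `I_n <-> exists2 s : seq T, size s <= n & X `<=` [set` s].
Proof.
split=> [Xn|[s le_sn Xs]].
  have X_fin : finite_set X by apply/finite_set_leP; exists n.
  exists (fset_set X); first exact: geq_card_fset_set.
  by move=> x Xx /=; rewrite in_fset_set //; apply: mem_set.
have X_sub : X `<=` [set` [fset x in s]%fset].
  by move=> x /Xs xs /=; rewrite inE.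
apply: card_le_trans (subset_card_le X_sub) _.
have /card_eq_fsetP s_card := card_fseq s.
by rewrite (card_le_eql s_card) card_le_II (leq_trans (size_undup s)).
Qed.

Lemma card_le_II_uniq (T : choiceType) (X : set T) (N : nat) :
  (forall r : seq T, uniq r -> [set` r] `<=` X -> size r <= N) -> X #<= `I_N.
Proof.
move=> le_N; have [/finite_fsetP[Y XY]|] := pselect (finite_set X).
  apply/card_le_II_seqP; exists Y; last by rewrite XY.
  by apply: le_N; rewrite ?fset_uniq // XY.
move=> /(@infinite_set_fset _ _ N.+1)[Y /(le_N _ (fset_uniq Y)) le_Y].
by rewrite ltnNge le_Y.
Qed.

Lemma card_le_II_bigcup_seq (I T : choiceType) (r : seq I) (F : I -> set T)
    (k : nat) :
  (forall i, i \in r -> F i #<= `I_k) ->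
  \bigcup_(i in [set` r]) F i #<= `I_(k * size r).
Proof.
move=> Fk; have /choice[s sP] i : exists s : seq T,
    i \in r -> size s <= k /\ F i `<=` [set` s].
  have [/Fk/card_le_II_seqP[s]|_] := boolP (i \in r); first by exists s.
  by exists [::].
apply/card_le_II_seqP; exists (flatten [seq s i | i <- r]).
  elim: r {Fk} sP => //= i r IHr sP.
  rewrite size_cat mulnS leq_add //; first by case: (sP i); rewrite ?mem_head.
  by apply: IHr => j jr; apply: sP; rewrite inE jr orbT.
move=> x [i /= ir Fix]; apply/flatten_mapP; exists i => //.
by have [_] := sP i ir; apply.
Qed.

Lemma cofinite_set_natP (X : set nat) :
  cofinite_set X <-> exists M, forall n, M <= n -> X n.
Proof.
split=> [/finite_seqP[s sE]|[M XM]].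
  exists (\max_(i <- s) i).+1 => n lt_n; apply: contrapT => nXn.
  have : (~` X) n by [].
  rewrite sE /= => ns.
  by have := leq_bigmax_seq (F := id) n ns isT; rewrite leqNgt lt_n.
apply: sub_finite_set (finite_II M) => n /= nXn.
by rewrite ltnNge; apply/negP => /XM.
Qed.

Definition nonmultiples (d : nat) (A : set nat) : set nat :=
  [set a | A a /\ ~~ (d %| a)].

Lemma nonmultiples_eq0 (d : nat) (A : set nat) :
  nonmultiples d A = set0 <-> forall a, A a -> d %| a.
Proof.
split=> [dA0 a Aa|dA]; last by apply/seteqP; split=> // a [/dA ->].
by apply: contrapT => /negP nda; suff : set0 a by []; rewrite -dA0.
Qed.

Lemma nonmultiplesD (d : nat) (A P : set nat) :
  nonmultiples d (A `\` P) = nonmultiples d A `\` P.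
Proof. by apply/seteqP; split=> a [[]]. Qed.

Section SumsAtMost.
Variable B : set nat.

Lemma sums_at_most0 (h : nat) : sums_at_most h B 0.
Proof. by exists [::]; split. Qed.

Lemma sums_at_most1 (b : nat) : B b -> sums_at_most 1 B b.
Proof.
move=> Bb; exists [:: b]; split=> [//|x|/=]; last by rewrite addn0.
by rewrite inE => /eqP ->.
Qed.

Lemma sums_at_mostD (h l m n : nat) :
  sums_at_most h B m -> sums_at_most l B n -> sums_at_most (h + l) B (m + n).
Proof.
move=> [s [sh sB ->]] [t [tl tB ->]]; exists (s ++ t); split.
- by rewrite size_cat leq_add.
- by move=> x; rewrite mem_cat => /orP[/sB|/tB].
- by rewrite sumn_cat.
Qed.

Lemma sums_at_mostM (h m n : nat) :
  sums_at_most h B n -> sums_at_most (m * h) B (m * n).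
Proof.
move=> hn; elim: m => [|m IHm]; first exact: sums_at_most0.
by rewrite !mulSn; apply: sums_at_mostD.
Qed.

Lemma sums_at_most_leq (h l n : nat) :
  h <= l -> sums_at_most h B n -> sums_at_most l B n.
Proof.
by move=> hl [s [sh sB nE]]; exists s; split=> //; apply: leq_trans hl.
Qed.

Lemma sums_at_most_order0 : sums_at_most 0 B = [set 0].
Proof.
apply/seteqP; split=> [n [s [+ _ ->]]|_ ->]; last exact: sums_at_most0.
by rewrite leqn0 size_eq0 => /eqP ->.
Qed.

Lemma sums_at_mostS (h : nat) :
  sums_at_most h.+1 B = [set b + m | b in 0 |` B & m in sums_at_most h B].
Proof.
apply/seteqP; split=> [n [[|b s] [sh sB ->]]|_ [b bB [m mB <-]]].
- by exists 0; [left|exists 0 => //; exact: sums_at_most0].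
- exists b; first by right; apply: sB; rewrite mem_head.
  exists (sumn s) => //; exists s; split=> // x xs.
  by apply: sB; rewrite inE xs orbT.
- case: bB => [->|/sums_at_most1 bB]; first exact: sums_at_most_leq mB.
  by rewrite -add1n; exact: sums_at_mostD.
Qed.

Lemma dvdn_sums_at_most (d h n : nat) :
  (forall b, B b -> d %| b) -> sums_at_most h B n -> d %| n.
Proof.
move=> dB [s [_ sB ->]].
by rewrite sumnE big_seq; apply: dvdn_sum => x /sB/dB.
Qed.

Lemma sums_at_most_consecutive (l s v V : nat) :
  sums_at_most l B s -> sums_at_most l B s.+1 -> v <= V ->
  sums_at_most (V * l) B (v + V * s).
Proof.
move=> ls lsS le_vV; have -> : v + V * s = v * s.+1 + (V - v) * s by nia.
have -> : V * l = v * l + (V - v) * l by nia.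
by apply: sums_at_mostD; apply: sums_at_mostM.
Qed.

Definition sum_difference : set nat :=
  [set d | exists h s, sums_at_most h B s /\ sums_at_most h B (s + d)].

Lemma sum_difference_gcdn (d e : nat) :
  sum_difference d -> sum_difference e -> sum_difference (gcdn d e).
Proof.
have [->|d_gt0] := posnP d; first by rewrite gcd0n.
move=> [h [s [hs hsd]]] [l [t [lt lte]]].
case: (egcdnP e d_gt0) => a c Bezout _.
exists (a * h + c * l), (a * s + c * (t + e)); split.
  by apply: sums_at_mostD; apply: sums_at_mostM.
have -> : a * s + c * (t + e) + gcdn d e = a * (s + d) + c * t by nia.
by apply: sums_at_mostD; apply: sums_at_mostM.
Qed.

Lemma sum_difference1 :
  (forall p, prime p -> nonmultiples p B !=set0) -> sum_difference 1.
Proof.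
move=> nonmult; have diffB b : B b -> sum_difference b.
  move=> Bb; exists 1, 0; split; first exact: sums_at_most0.
  exact: sums_at_most1.
have exD : exists d, (0 < d) && `[< sum_difference d >].
  have [b [Bb b_odd]] := nonmult 2 isT.
  exists b; apply/andP; split; first by case: b b_odd {Bb}.
  exact/asboolP/diffB.
have [d /andP[d_gt0 /asboolP diff_d] d_min] := ex_minnP exD.
have [d_le1|d_gt1] := leqP d 1; first by rewrite (_ : 1 = d) //; lia.
have [b [Bb]] := nonmult (pdiv d) (pdiv_prime d_gt1).
rewrite (dvdn_trans (pdiv_dvd d)) //.
suff <- : gcdn d b = d by exact: dvdn_gcdr.
apply/eqP; rewrite eqn_leq (dvdn_leq d_gt0 (dvdn_gcdl d b)) d_min //.
rewrite gcdn_gt0 d_gt0; apply/asboolP.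
by apply: sum_difference_gcdn; last exact: diffB.
Qed.

End SumsAtMost.

Lemma nonmultiples_eq0_not_asymptotic_basis (d : nat) (B : set nat) :
  d != 1 -> nonmultiples d B = set0 -> ~ asymptotic_basis B.
Proof.
move=> d_neq1 /nonmultiples_eq0 dB [h _ /cofinite_set_natP[M BM]].
have d_sum n : M <= n -> d %| n by move/BM; apply: dvdn_sums_at_most.
have := d_sum M.+1 (leqnSn M).
by rewrite -addn1 (dvdn_addr _ (d_sum M (leqnn M))) dvdn1 (negPf d_neq1).
Qed.

Lemma sums_at_most_setD (A P : set nat) (h m n : nat) :
  (forall x, P x -> x <= m) -> sums_at_most h A n ->
  exists w v, [/\ sums_at_most h (A `\` P) w, v <= h * m & n = w + v].
Proof.
move=> Pm; elim: h n => [|h IHh] n.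
  rewrite sums_at_most_order0 => ->; exists 0, 0.
  by split=> //; exact: sums_at_most0.
rewrite sums_at_mostS => -[a Aa [_ /IHh[w [v [hw vV ->]]] <-]].
have [Pa|nPa] := pselect (P a).
  exists w, (a + v); split; last by rewrite addnCA.
    exact: sums_at_most_leq hw.
  by rewrite mulSn leq_add // Pm.
exists (a + w), v; split; last by rewrite addnA.
  rewrite sums_at_mostS; exists a; last by exists w.
  by case: Aa => [->|Aa]; [left|right].
exact: leq_trans vV (leq_mul _ _).
Qed.

Lemma asymptotic_basis_setD (A P : set nat) :
  asymptotic_basis A -> finite_set P ->
  (forall p, prime p -> nonmultiples p (A `\` P) !=set0) ->
  asymptotic_basis (A `\` P).
Proof.
move=> [h h_gt0 /cofinite_set_natP[M AM]] P_fin /sum_difference1[l [s [ls]]].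
rewrite addn1 => lsS.
have [m Pm] : exists m, forall x, P x -> x <= m.
  move: P_fin; rewrite -[P]setCK => /cofinite_set_natP[m nPm].
  exists m => x; apply: contra_notT; rewrite -ltnNge => /ltnW; exact: nPm.
pose V := h * m; exists (h + V * l); first by rewrite addn_gt0 h_gt0.
apply/cofinite_set_natP; exists (M + V * s) => n le_n.
have [|w [v [hw vV nE]]] := @sums_at_most_setD A P h m (n - V * s) Pm.
  by apply: AM; lia.
have -> : n = w + (v + V * s) by lia.
by apply: sums_at_mostD => //; apply: sums_at_most_consecutive.
Qed.

Lemma essential_subset_nonmultiples (A P : set nat) :
  essential_subset A P -> exists2 p, prime p & P = nonmultiples p A.
Proof.
move=> [[A_basis PA AP_nbasis P_min] P_fin].
have [p p_pr pAP] : exists2 p, prime p & nonmultiples p (A `\` P) = set0.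
  apply: contrapT => nodiv; apply/AP_nbasis/asymptotic_basis_setD => // p p_pr.
  by apply/set0P/eqP => pAP; apply: nodiv; exists p.
exists p => //; apply/esym/P_min; first by move=> a [].
  apply: (@nonmultiples_eq0_not_asymptotic_basis p).
    by rewrite neq_ltn prime_gt1 ?orbT.
  by rewrite nonmultiplesD setDv.
by rewrite -setD_eq0 -nonmultiplesD.
Qed.

Lemma nonmultiples_prod (r : seq nat) (A : set nat) :
  pairwise coprime r -> nonmultiples (\prod_(d <- r) d) A
    `<=` \bigcup_(d in [set` r]) nonmultiples d A.
Proof.
move=> r_cop a [Aa nda]; have : ~~ all (dvdn^~ a) r.
  apply: contra nda => /allP dr; apply/Gauss_dvd_prod => [|d /dr //].
  by rewrite filter_predT map_id.
by move=> /allPn[d dr nd]; exists d.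
Qed.

Lemma sums_at_most_modn (h q : nat) (A : set nat) (L : seq nat) :
  (forall a, (0 |` A) a -> a %% q \in L) ->
  exists2 R : seq nat, size R = size L ^ h &
    forall n, sums_at_most h A n -> n %% q \in R.
Proof.
move=> AL; elim: h => [|h [R sizeR RP]].
  by exists [:: 0] => // n; rewrite sums_at_most_order0 => ->; rewrite mod0n.
exists [seq (a + m) %% q | a <- L, m <- R].
  by rewrite size_allpairs sizeR expnS.
move=> n; rewrite sums_at_mostS => -[a /AL aL [m /RP mR <-]].
by rewrite -modnDm; apply: allpairs_f.
Qed.

Lemma asymptotic_basis_modulus_leq (h k q : nat) (A : set nat) :
  asymptotic_basis_of_order h A -> nonmultiples q A #<= `I_k -> q <= k.+1 ^ h.
Proof.
move=> /cofinite_set_natP[M AM] /card_le_II_seqP[s le_sk qs].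
have [a Aa|R sizeR RP] := @sums_at_most_modn h q A (0 :: [seq a %% q | a <- s]).
  have [/eqP->|nqa] := boolP (q %| a); first exact: mem_head.
  case: Aa => [a0|Aa]; first by rewrite a0 dvdn0 in nqa.
  by apply/mem_behead/(map_f (modn^~ q))/qs.
have residues : {subset iota 0 q <= R}.
  move=> i; rewrite mem_iota => /= lt_iq.
  rewrite -(modn_small lt_iq) -(modnMDl M); apply/RP/AM; nia.
have := uniq_leq_size (iota_uniq 0 q) residues.
rewrite size_iota sizeR /= size_map => /leq_trans; apply.
exact: leqW_exp2r.
Qed.

Lemma asymptotic_basis_moduli_leq (b h k : nat) (A : set nat) (r : seq nat) :
  asymptotic_basis_of_order h A -> pairwise coprime r -> all (leq b) r ->
  (forall d, d \in r -> nonmultiples d A #<= `I_k) ->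
  b ^ size r <= (k * size r).+1 ^ h.
Proof.
move=> Ah r_cop r_ge rk; apply: leq_trans (leq_exp_prod r_ge) _.
apply: (asymptotic_basis_modulus_leq Ah).
apply: card_le_trans (card_le_II_bigcup_seq rk).
exact/subset_card_le/nonmultiples_prod.
Qed.

Theorem theorem2p1 (k h : nat) (k_gt0 : (0 < k)%N) (h_gt0 : (0 < h)%N) :
  exists phi : nat, forall A : set nat, asymptotic_basis_of_order h A ->
    [set P : set nat | essential_subset A P /\ P #<= `I_k] #<= `I_phi.
Proof.
have [N ltN] := linear_exp_ltn_exp_eventually k h (isT : 1 < 2).
exists N => A Ah.
pose T := [set p | prime p /\ nonmultiples p A #<= `I_k].
have T_le : T #<= `I_N.
  apply: card_le_II_uniq => r r_uniq rT.
  rewrite leqNgt; apply/negP => /ltnW/ltN; rewrite ltnNge => /negP; apply.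
  have r_pr : all prime r by apply/allP => p /rT[].
  apply: (asymptotic_basis_moduli_leq Ah).
  - exact: uniq_prime_pairwise_coprime.
  - by apply: sub_all r_pr => p /prime_gt1.
  - by move=> p /rT[].
apply: card_le_trans T_le.
apply: card_le_trans (card_image_le (nonmultiples^~ A) T).
apply: subset_card_le => P [/essential_subset_nonmultiples[p p_pr ->] Pk].
by exists p.
Qed.
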